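(* Let $n$ be a positive integer, $\zeta_n$ a primitive $n$-th root of unity and $\delta_n=\zeta_n+\zeta_n^{-1}$. Then (1) the field $\mathbb{Q}[\delta_n]$ is represented by some symmetric $0,1$-circulant matrix of order $n$; (2) for every subfield $\mathbb{L}$ of $\mathbb{Q}[\delta_n]$ there exists a symmetric circulant matrix with rational entries that represents $\mathbb{L}$.
   Context: A matrix $A$ with rational entries is said to represent a field extension $\mathbb{K}$ of $\mathbb{Q}$ if there exists an irreducible polynomial $q(x)\in\mathbb{Q}[x]$ dividing the minimal polynomial of $A$ such that $\mathbb{K}\cong \mathbb{Q}[A]/\langle q(A)\rangle$, where $\mathbb{Q}[A]$ is the algebra of polynomials in $A$ and $\langle q(A)\rangle$ is the ideal it generates. *)

(* Defs.v *)
From HB Require Import structures.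
From mathcomp Require Import all_boot all_order all_algebra all_field.
From mathcomp Require Import boolp.

Set Implicit Arguments.
Unset Strict Implicit.
Unset Printing Implicit Defensive.

Import GRing.Theory.
Local Open Scope ring_scope.

Section PolynomialAlgebra.
Variables (n : nat) (A : 'M[rat]_n.+1).

Definition is_poly_of : {pred 'M[rat]_n.+1} :=
  fun B => `[< exists p : {poly rat}, B = horner_mx A p >].

Fact is_poly_of_subring : subring_closed is_poly_of.
Proof.
split.
- by apply/asboolP; exists 1; rewrite rmorph1.
- move=> B C /asboolP[p ->] /asboolP[q ->].
  by apply/asboolP; exists (p - q); rewrite rmorphB.
- move=> B C /asboolP[p ->] /asboolP[q ->].
  by apply/asboolP; exists (p * q); rewrite rmorphM.
Qed.

HB.instance Definition _ :=
  GRing.isSubringClosed.Build _ is_poly_of is_poly_of_subring.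

(* The algebra Q[A] of polynomials in A, as a commutative ring. *)
Record polyalg := PolyAlg { polyalg_val : 'M[rat]_n.+1;
                            _ : polyalg_val \in is_poly_of }.

HB.instance Definition _ := [isSub for polyalg_val].
HB.instance Definition _ := [Choice of polyalg by <:].
HB.instance Definition _ := [SubChoice_isSubNzRing of polyalg by <:].

Fact polyalg_mulC : commutative (@GRing.mul polyalg).
Proof.
move=> [B HB] [C HC]; apply: val_inj; rewrite !rmorphM /=.
have /asboolP[p ->] := HB; have /asboolP[q ->] := HC.
exact: comm_horner_mx2.
Qed.

HB.instance Definition _ :=
  GRing.PzRing_hasCommutativeMul.Build polyalg polyalg_mulC.

Fact horner_mx_polyalg (q : {poly rat}) : horner_mx A q \in is_poly_of.
Proof. by apply/asboolP; exists q. Qed.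

Definition polyalg_horner (q : {poly rat}) : polyalg :=
  PolyAlg (horner_mx_polyalg q).

End PolynomialAlgebra.

Definition is_principal_ideal (R : comNzRingType) (a : R) (I : {pred R}) : Prop :=
  forall x : R, x \in I <-> exists r : R, x = r * a.

(* {ideal_quot I} is only available for proper ideals I; the generator q(A)
   determines I, and the quotient, being isomorphic to a field, is non trivial,
   so asking for a proper ideal is no restriction. A ring isomorphism between
   Q-algebras is automatically Q-linear. *)
Definition represents (n : nat) (A : 'M[rat]_n.+1) (K : fieldExtType rat) : Prop :=
  exists q : {poly rat},
    [/\ irreducible_poly q,
        q %| mxminpoly A
      & exists I : idealr (polyalg A),
          is_principal_ideal (polyalg_horner A q) I /\
          exists f : {rmorphism K -> {ideal_quot I}}, bijective f].

(* The subtraction j - i is that of 'I_n.+1, i.e. modulo n.+1. *)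
Definition circulant (n : nat) (A : 'M[rat]_n.+1) : Prop :=
  exists c : 'I_n.+1 -> rat, forall i j : 'I_n.+1, A i j = c (j - i).

Definition zero_one_mx (m n : nat) (A : 'M[rat]_(m, n)) : Prop :=
  forall i j, A i j = 0 \/ A i j = 1.

(* Main.v *)
From HB Require Import structures.
Require Import Defs.
From mathcomp Require Import all_boot all_order all_algebra all_field.
From mathcomp Require Import boolp.

Import GRing.Theory.
Local Open Scope ring_scope.

(** Let [v] be the column of powers of [zeta]. Every circulant matrix has [v] as
    an eigenvector, and when [A v = w v], evaluation at [w] induces a surjection
    [Q[A] -> Q(w)] whose kernel is generated by [q(A)], for [q] the minimal
    polynomial of [w]; so [A] represents [Q(w)]. The adjacency matrix of the
    [n]-cycle has eigenvalue [delta] ([zeta = delta / 2] in the degenerate case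
    [zeta = zeta^-1]). A subfield of [Q(delta)] is generated by some [r(delta)]
    by the primitive element theorem, and it is represented by [r(A)]. *)

(** * First isomorphism theorem for quotients by a kernel *)

Section KernelIdeal.
Variables (R : comNzRingType) (S : nzRingType) (phi : {rmorphism R -> S}).

Definition rker : {pred R} := fun x => phi x == 0.

Lemma rkerE x : (x \in rker) = (phi x == 0). Proof. by []. Qed.

Fact rker_idealr : idealr_closed rker.
Proof.
split=> [||a x y]; rewrite !rkerE ?rmorph0 ?rmorph1 ?oner_eq0 //.
by move=> /eqP x0 /eqP y0; rewrite rmorphD rmorphM /= x0 y0 mulr0 addr0.
Qed.

HB.instance Definition _ := isIdealr.Build R rker rker_idealr.

Lemma eq_quot_rker (x y : R) :
  (x == y %[mod {ideal_quot rker}])%qT = (phi x == phi y).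
Proof. by rewrite -Quotient.idealrBE rkerE rmorphB subr_eq0. Qed.

(** The two image conditions say that [phi] and [g] have the same range, so [K] only has to embed
    onto the image of [phi]; this suits a subfield [K] of [S]. *)
Lemma ideal_quot_rker_iso (K : nzRingType) (g : {rmorphism K -> S}) :
    injective g -> (forall x, exists y, phi x = g y) ->
    (forall y, exists x, phi x = g y) ->
  exists f : {rmorphism K -> {ideal_quot rker}}, bijective f.
Proof.
move=> g_inj phi_im g_im.
have [h hP] := choice g_im; have [k kP] := choice phi_im.
(* A class modulo [rker] is determined by its value under [phi], so the choice of preimages [h] does
   not affect [f], which is therefore a morphism. Choosing [g]-preimages of those values with [k]
   gives the inverse. *)
pose f y : {ideal_quot rker} := (\pi_({ideal_quot rker}) (h y))%qT.
have fB : zmod_morphism f.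
  move=> x y; apply/eqP; rewrite /f -rmorphB eq_quot_rker.
  by rewrite rmorphB /= !hP rmorphB.
have fM : monoid_morphism f.
  split=> [|x y]; apply/eqP; rewrite /f.
    by rewrite -(rmorph1 (\pi_({ideal_quot rker})%qT)) eq_quot_rker hP !rmorph1.
  by rewrite -rmorphM eq_quot_rker rmorphM /= !hP rmorphM.
pose fA := GRing.isZmodMorphism.Build _ _ f fB.
pose fR := GRing.isMonoidMorphism.Build _ _ f fM.
pose F : {rmorphism K -> {ideal_quot rker}} := HB.pack f fA fR.
exists F; exists (fun x => k (repr x)) => [y|x] /=.
  apply: g_inj; rewrite -kP -hP; apply/eqP.
  by rewrite -eq_quot_rker reprK.
by rewrite -[RHS]reprK; apply/eqP; rewrite eq_quot_rker hP -kP.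
Qed.

End KernelIdeal.

Lemma horner_mx_eigenvector (R : comNzRingType) n (A : 'M[R]_n.+1)
    (v : 'cV_n.+1) w p :
  A *m v = w *: v -> horner_mx A p *m v = p.[w] *: v.
Proof.
move=> Av; elim/poly_ind: p => [|p c IHp].
  by rewrite rmorph0 mul0mx horner0 scale0r.
rewrite rmorphD rmorphM /= horner_mx_X horner_mx_C mulmxDl.
rewrite -mulmxA Av -scalemxAr IHp mul_scalar_mx !hornerE scalerDl scalerA.
by rewrite mulrC.
Qed.

Lemma trmx_horner_mx (R : comNzRingType) n (A : 'M[R]_n.+1) p :
  (horner_mx A p)^T = horner_mx A^T p.
Proof.
elim/poly_ind: p => [|p c IHp]; first by rewrite !rmorph0 trmx0.
rewrite !rmorphD !rmorphM /= !horner_mx_X !horner_mx_C linearD /= tr_scalar_mx.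
by rewrite trmx_mul IHp [A^T *m _]comm_mx_horner.
Qed.

Lemma polyalg_hornerP n (A : 'M[rat]_n.+1) (x : polyalg A) :
  exists p, x = polyalg_horner A p.
Proof.
by case: x => B HB; have /asboolP[p Dp] := HB; exists p; apply: val_inj.
Qed.

(** * Evaluation of [Q[A]] at an eigenvalue *)

Section PolyalgEigenvalue.
Variables (n : nat) (A : 'M[rat]_n.+1) (E : fieldExtType rat).
Variables (w : E) (v : 'cV[E]_n.+1) (i0 : 'I_n.+1).
Hypotheses (v1 : v i0 0 = 1) (Av : map_mx (in_alg E) A *m v = w *: v).

(** As [v] is normalised to 1 at [i0], this coordinate is the eigenvalue of [x] on [v]. Reading it
    off the matrix avoids choosing a polynomial that represents [x]. *)
Definition polyalg_eigenvalue (x : polyalg A) : E :=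
  (map_mx (in_alg E) (val x) *m v) i0 0.

Lemma polyalg_eigenvalue_horner p :
  polyalg_eigenvalue (polyalg_horner A p) = (map_poly (in_alg E) p).[w].
Proof.
rewrite /polyalg_eigenvalue /= map_horner_mx.
by rewrite (horner_mx_eigenvector _ _ _ _ _ _ Av) mxE v1 mulr1.
Qed.

Fact polyalg_eigenvalue_zmod : zmod_morphism polyalg_eigenvalue.
Proof.
move=> x y.
have [p ->] := polyalg_hornerP _ _ x; have [q ->] := polyalg_hornerP _ _ y.
have -> : polyalg_horner A p - polyalg_horner A q = polyalg_horner A (p - q).
  by apply: val_inj; rewrite /= !rmorphB.
by rewrite !polyalg_eigenvalue_horner rmorphB hornerD hornerN.
Qed.

Fact polyalg_eigenvalue_monoid : monoid_morphism polyalg_eigenvalue.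
Proof.
split=> [|x y].
  have -> : 1 = polyalg_horner A 1 by apply: val_inj; rewrite /= !rmorph1.
  by rewrite polyalg_eigenvalue_horner rmorph1 hornerC.
have [p ->] := polyalg_hornerP _ _ x; have [q ->] := polyalg_hornerP _ _ y.
have -> : polyalg_horner A p * polyalg_horner A q = polyalg_horner A (p * q).
  by apply: val_inj; rewrite /= rmorphM.
by rewrite !polyalg_eigenvalue_horner rmorphM hornerM.
Qed.

HB.instance Definition _ :=
  GRing.isZmodMorphism.Build _ _ polyalg_eigenvalue polyalg_eigenvalue_zmod.
HB.instance Definition _ :=
  GRing.isMonoidMorphism.Build _ _ polyalg_eigenvalue polyalg_eigenvalue_monoid.

Lemma eigenvalue_represents (L : {subfield E}) :
  L = <<1; w>>%VS :> {vspace E} -> represents A (subvs_of L).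
Proof.
move=> defL; have /polyOver1P[q Dq] := minPolyOver 1%AS w.
(* The rational polynomials vanishing at [w] are the multiples of [q]. This gives both
   [q %| mxminpoly A] and the principality of the kernel. *)
have dvdq p : (q %| p) = ((map_poly (in_alg E) p).[w] == 0).
  rewrite -(dvdp_map (in_alg E)) -Dq; apply/idP/idP => [/root_dvdp|pw0].
    by apply; apply: root_minPoly.
  by rewrite minPoly_dvdp //; apply/polyOver1P; exists p.
exists q; split.
(* The embedding into [{poly E}] preserves sizes and reflects divisibility, so irreducibility is
   inherited from [minPoly] over [1%AS]. *)
- split=> [|p p1 dvd_pq].
    by rewrite -(size_map_poly (in_alg E)) -Dq size_minPoly.
  have := @minPoly_irr _ _ 1%AS w (map_poly (in_alg E) p).
  rewrite Dq dvdp_map eqp_map -(rmorph1 (map_poly (in_alg E))) eqp_map.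
  case/(_ _ dvd_pq)/orP=> //; first by apply/polyOver1P; exists p.
  by move/eqp_size; rewrite size_poly1 => /eqP; rewrite (negPf p1).
- rewrite dvdq -polyalg_eigenvalue_horner.
  have -> : polyalg_horner A (mxminpoly A) = 0.
    by apply: val_inj; rewrite /= mx_root_minpoly.
  by rewrite rmorph0.
exists (rker _ _ polyalg_eigenvalue); split.
  move=> x; rewrite rkerE /=; have [p ->] := polyalg_hornerP _ _ x.
  rewrite polyalg_eigenvalue_horner -dvdq; split=> [/dvdpP[r ->]|[r Dr]].
    by exists (polyalg_horner A r); apply: val_inj; rewrite /= !rmorphM.
  rewrite dvdq -polyalg_eigenvalue_horner Dr rmorphM /=.
  by rewrite polyalg_eigenvalue_horner -Dq minPolyxx mulr0.
apply: (ideal_quot_rker_iso _ _ _ _ (vsval : {rmorphism _ -> _})).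
- exact: val_inj.
- move=> x; have [p ->] := polyalg_hornerP _ _ x; rewrite /= polyalg_eigenvalue_horner.
  have Lpw : (map_poly (in_alg E) p).[w] \in L.
    by rewrite defL; apply/Fadjoin1_polyP; exists p.
  by exists (Subvs Lpw).
have sLw : (L <= <<1; w>>)%VS by rewrite defL.
move=> y; have /Fadjoin1_polyP[p Dp] := subvP sLw _ (subvsP y).
by exists (polyalg_horner A p); rewrite /= polyalg_eigenvalue_horner.
Qed.

End PolyalgEigenvalue.

(** * Closure properties of circulant matrices *)

Section Circulant.
Variable n : nat.
Implicit Types A B : 'M[rat]_n.+1.

Lemma circulantD A B : circulant A -> circulant B -> circulant (A + B).
Proof.
move=> [a Aa] [b Bb]; exists (fun k => a k + b k) => i j.
by rewrite mxE Aa Bb.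
Qed.

(** Coefficient functions multiply by cyclic convolution, after the summation index is shifted by
    [i]. *)
Lemma circulantM A B : circulant A -> circulant B -> circulant (A *m B).
Proof.
move=> [a Aa] [b Bb]; exists (fun k => \sum_m a m * b (k - m)) => i j.
rewrite mxE (reindex_inj (addIr i)); apply: eq_bigr => k _ /=.
by rewrite Aa Bb addrK opprD addrA addrAC.
Qed.

Lemma circulant_scalar (c : rat) : circulant (c%:M : 'M_n.+1).
Proof.
exists (fun k => c *+ (k == 0)) => i j.
by rewrite mxE subr_eq0 eq_sym.
Qed.

Lemma circulant_horner_mx A p : circulant A -> circulant (horner_mx A p).
Proof.
move=> Ac; elim/poly_ind: p => [|p c IHp].
  by rewrite rmorph0 -(raddf0 (@scalar_mx _ _)); apply: circulant_scalar.
rewrite rmorphD rmorphM /= horner_mx_X horner_mx_C.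
by apply: circulantD; [apply: circulantM | apply: circulant_scalar].
Qed.

End Circulant.

(** * The adjacency matrix of the cycle and its eigenvalue *)

Section CycleAdjacency.
Variable n : nat.

(* [inZp 1] is [0] when [n = 0]. *)
Definition cycle_step (k : 'I_n.+1) : bool := (k == inZp 1) || (k == - inZp 1).

(** The boolean disjunction counts coinciding neighbours once, so the entries stay in 0, 1 even in
    orders 1 and 2. *)
Definition cycle_adjacency : 'M[rat]_n.+1 :=
  \matrix_(i, j) (cycle_step (j - i))%:R.

Lemma circulant_cycle_adjacency : circulant cycle_adjacency.
Proof. by exists (fun k => (cycle_step k)%:R) => i j; rewrite mxE. Qed.

Lemma tr_cycle_adjacency : cycle_adjacency^T = cycle_adjacency.
Proof.
apply/matrixP=> i j; rewrite !mxE -opprB /cycle_step.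
by rewrite eqr_oppLR eqr_opp orbC.
Qed.

Lemma zero_one_cycle_adjacency : zero_one_mx cycle_adjacency.
Proof. by move=> i j; rewrite mxE; case: cycle_step; [right | left]. Qed.

Variables (E : fieldExtType rat) (zeta : E).
Hypothesis zeta_prim : n.+1.-primitive_root zeta.

Lemma prim_exprD (i j : 'I_n.+1) :
  zeta ^+ (i + j)%R = zeta ^+ i * zeta ^+ j.
Proof. by rewrite -exprD (prim_expr_mod zeta_prim). Qed.

(** This covers [n = 0] too: the exponent is then 0, but [zeta] is 1. *)
Lemma prim_expr_inZp1 : zeta ^+ (inZp 1 : 'I_n.+1) = zeta.
Proof. by rewrite (prim_expr_mod zeta_prim). Qed.

Lemma prim_exprN (i : 'I_n.+1) : zeta ^+ (- i)%R = (zeta ^+ i)^-1.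
Proof. by apply: divr1_eq; rewrite invrK -prim_exprD addNr. Qed.

Lemma cycle_adjacency_eigenvector :
  map_mx (in_alg E) cycle_adjacency *m (\col_i zeta ^+ i) =
    (\sum_(k | cycle_step k) zeta ^+ k) *: \col_i zeta ^+ i.
Proof.
apply/matrixP=> i j; rewrite !mxE (reindex_inj (addIr i)) /= [in RHS]big_mkcond mulr_suml.
apply: eq_bigr => k _; rewrite !mxE addrK prim_exprD rmorph_nat.
by case: cycle_step; rewrite ?mul1r ?mul0r.
Qed.

Lemma adjoin_cycle_eigenvalue :
  <<1; \sum_(k | cycle_step k) zeta ^+ k>>%VS = <<1; zeta + zeta^-1>>%VS.
Proof.
(* If [1 = -1] modulo [n.+1], the sum has the single term [zeta], while [zeta + zeta^-1] is twice
   it; both generate the same field. Otherwise the two sums coincide. *)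
have [u_eqN | u_neqN] := eqVneq (inZp 1 : 'I_n.+1) (- inZp 1).
  rewrite (big_pred1 (inZp 1)) => [|k]; last first.
    by rewrite /cycle_step -u_eqN orbb.
  have := prim_exprN (inZp 1); rewrite -u_eqN prim_expr_inZp1 => <-.
  rewrite -mulr2n -scaler_nat; apply/eqP; rewrite eqEsubv !sub_adjoin1v.
  rewrite [_ *: zeta \in _]memvZ ?memv_adjoin // andbT.
  have {1}-> : zeta = 2%:R^-1 *: (2%:R *: zeta) by rewrite scalerA mulVf ?scale1r.
  by rewrite memvZ ?memv_adjoin.
rewrite (bigD1 (inZp 1)) /=; last by rewrite /cycle_step eqxx.
rewrite (big_pred1 (- inZp 1)) => [|k]; last first.
  rewrite /cycle_step; case: eqVneq => [->|] /=; last by rewrite andbT.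
  by rewrite (negPf u_neqN).
by rewrite prim_exprN prim_expr_inZp1.
Qed.

End CycleAdjacency.

Lemma rat_ext_primitive_element (E : fieldExtType rat) (L : {subfield E}) :
  exists w, L = <<1; w>>%VS :> {vspace E}.
Proof.
exists (separable_generator 1%AS L); apply: eq_adjoin_separable_generator.
  (* Characteristic 0 makes every element separable. *)
  apply/separableP => x _; apply: pcharf0_separable => p.
  by rewrite (fmorph_pchar (in_alg E)) Num.Theory.pchar_num.
exact: sub1v.
Qed.

Theorem theorem2p5 (n : nat) (E : fieldExtType rat) (zeta : E)
    (zeta_prim : n.+1.-primitive_root zeta) :
  let delta := zeta + zeta^-1 in
  (exists A : 'M[rat]_n.+1,
     [/\ circulant A, A^T = A, zero_one_mx A
       & represents A (subvs_of <<1; delta>>%AS)]) /\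
  (forall L : {subfield E}, (L <= <<1; delta>>)%VS ->
     exists A : 'M[rat]_n.+1,
       [/\ circulant A, A^T = A & represents A (subvs_of L)]).
Proof.
move=> delta.
pose A := cycle_adjacency n.
have A_circ : circulant A := circulant_cycle_adjacency n.
have A_sym : A^T = A := tr_cycle_adjacency n.
have Av := cycle_adjacency_eigenvector _ _ _ zeta_prim.
have defQ := adjoin_cycle_eigenvalue _ _ _ zeta_prim.
have v1 : (\col_(i < n.+1) zeta ^+ i) 0 0 = 1 by rewrite mxE.
split=> [|L sLQ].
  exists A; split=> //; first exact: zero_one_cycle_adjacency.
  by apply: (eigenvalue_represents _ _ _ _ _ _ v1 Av); rewrite /= defQ.
have [w defL] := rat_ext_primitive_element _ L.
(* The polynomial [p] is taken in the eigenvalue of [A] rather than in [delta], so that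
   [horner_mx A p] has eigenvalue exactly [w] on the same vector. *)
have: w \in L by rewrite defL memv_adjoin.
move/(subvP sLQ); rewrite -defQ => /Fadjoin1_polyP[p Dw].
exists (horner_mx A p); split.
- exact: circulant_horner_mx.
- by rewrite trmx_horner_mx A_sym.
apply: (eigenvalue_represents _ _ _ _ _ _ v1 _ _ defL).
by rewrite map_horner_mx (horner_mx_eigenvector _ _ _ _ _ _ Av) -Dw.
Qed.
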